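(* In the setting described in the context (unknown LTI system, noisy offline data, the sets $\mathcal Z,\hat{\mathcal U},\mathcal Z_f,\mathcal E,\mathcal V$ and the optimal control problem OCP$(\hat x)$), suppose that (A1)--(A7) hold. Consider the closed loop $x_{k+1}=A^\ast x_k+B^\ast u_k$, $\hat x_k=x_k+w_k$, $w_k\in\mathcal W$, with $u_k=v^\star_{0|k}+K\hat x_k$, where $v^\star_{0|k}$ is the first element of the optimal sequence $V_k^\star$ of OCP$(\hat x_k)$. If the measured state at time $k$ satisfies $\hat x_k\in\hat{\mathcal X}_L^{\mathrm{feas}}$ (equivalently, OCP$(\hat x_k)$ is feasible), then the problem is also feasible at time $k+1$, i.e. $\hat x_{k+1}\in\hat{\mathcal X}_L^{\mathrm{feas}}$. In particular, if $\hat x_0\in\hat{\mathcal X}_L^{\mathrm{feas}}$, then $\hat x_k\in\hat{\mathcal X}_L^{\mathrm{feas}}$ for all $k\in\mathbb N_0$.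
   Context: **Sets and Hankel matrices.** For $\mathcal A,\mathcal B\subset\mathbb R^n$: $\mathcal A\oplus\mathcal B=\{a+b: a\in\mathcal A, b\in\mathcal B\}$, $\mathcal A\ominus\mathcal B=\{x:\{x\}\oplus\mathcal B\subseteq\mathcal A\}$; $\operatorname{co}$ is the convex hull. $\mathbb N_{a:b}=\{a,\dots,b\}$, $\mathbb N_0=\{0,1,2,\dots\}$. For a sequence $s_0,\dots,s_{T-1}$ and $0\le L<T$, the block Hankel matrix $H_s$ of depth $L+1$ has $L+1$ block rows (indexed $0,\dots,L$) and $T-L$ columns; its $\ell$-th block row is $H_{s_{[\ell]}}=[\,s_\ell\ s_{\ell+1}\ \cdots\ s_{\ell+T-L-1}\,]$; $H_{s_{[i:j]}}$ stacks block rows $i,\dots,j$. $\Delta^{T-L}=\{g\in\mathbb R^{T-L}: g\ge0,\ \mathbf 1^\top g=1\}$. **System.** $x_{k+1}=A^\ast x_k+B^\ast u_k$, $\hat x_k=x_k+w_k$, with $x_k\in\mathbb R^n$, $u_k\in\mathbb R^m$, $(A^\ast,B^\ast)$ unknown, fixed and controllable. Constraint sets $\mathcal U\subset\mathbb R^m$, $\mathcal X\subset\mathbb R^n$ are convex polytopes with the origin in their interiors. **(A1)** Offline data $u^d_{[0:T-1]},\hat x^d_{[0:T-1]}$ are available, with $x^d_{i+1}=A^\ast x^d_i+B^\ast u^d_i$, $\hat x^d_i=x^d_i+w^d_i$; $0<L<T$; $u^d$ is persistently exciting of order $L+n+1$ (its depth-$(L+n+1)$ Hankel matrix has full row rank $m(L+n+1)$).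 $H_u$, $\hat H_x$ denote the depth-$(L+1)$ Hankel matrices of $u^d$, $\hat x^d$. **(A2)** All noise samples (offline $w^d_i$ and online $w_k$) lie in $\mathcal W=\{w\in\mathbb R^n: G_ww\le h_w\}$, a known, compact, convex polytope containing the origin. Write $\|x\|_{\mathcal W}=\inf\{t\ge0:x\in t\mathcal W\}$ for the gauge of $\mathcal W$ and $\|A\|_{\mathcal W}=\sup_{w\in\mathcal W}\|Aw\|_{\mathcal W}$ for the induced gain. A constant $\gamma^\ast\ge\|A^\ast\|_{\mathcal W}$ is given. **(A3)** The matrix $\begin{bmatrix} \hat x^d_0 & \cdots & \hat x^d_{T-2} \\ u^d_0 & \cdots & u^d_{T-2} \end{bmatrix}$ has full row rank $n+m$. **Data-consistent models.** $\mathcal I$ is the set of $(A,B)$ with $G_w(\hat x^d_{i+1}-A\hat x^d_i-Bu^d_i)\le(1+\gamma^\ast)h_w$ for all $i\in\mathbb N_{0:T-2}$ (a nonempty compact polytope under (A1)--(A3)). For the feedback gain $K\in\mathbb R^{m\times n}$, $\mathcal A_K=\{A+BK:(A,B)\in\mathcal I\}$ and $\mathcal A_K\mathcal S=\{Ms: M\in\mathcal A_K,s\in\mathcal S\}$. The gain $K$ is such that for some $P=P^\top\succ0$, $\beta>0$: $(A+BK)P(A+BK)^\top-P\preceq-\beta I$ for all $(A,B)\in\mathcal I$. **Initial set.** $\mathcal E$ is a compact polytope with $\mathcal A_K\mathcal E\oplus D\subseteq\mathcal E$, where $D=2(1+\gamma^\ast)\mathcal W$. **Tightened sets.** $\mathcal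 E_{\mathrm{off}}=(1+\gamma^\ast)\mathcal W$, $\mathcal E_{\mathrm{on}}=\operatorname{co}(\mathcal A_K\mathcal E)$, $\mathcal E_w=\gamma^\ast\mathcal W$; $\mathcal Z=\mathcal X\ominus\mathcal E_{\mathrm{off}}\ominus\mathcal E_{\mathrm{on}}\ominus\mathcal E_w$, $\hat{\mathcal U}=\mathcal U\ominus K\mathcal E$. **(A4)** $\mathcal Z\ne\varnothing$ and $\hat{\mathcal U}\neq\varnothing$. **(A5)** $\mathcal V\subset\mathbb R^m$ is a compact convex polytope with $(H_{u_{[L]}}-K\hat H_{x_{[L]}})g\in\mathcal V$ for all $g\in\Delta^{T-L}$. **(A6)** With $\mathcal B\mathcal V=\operatorname{co}\{Bv:(A,B)\in\mathcal I\text{ for some }A,\ v\in\mathcal V\}$, $\Omega=(1+\gamma^\ast)\mathcal W\oplus\mathcal B\mathcal V$ and $\mathcal M_\infty=\bigoplus_{i=0}^\infty\operatorname{co}(\mathcal A_K^i\Omega)$ ($\mathcal A_K^i\Omega$: images of $\Omega$ under all $i$-fold products of elements of $\mathcal A_K$), $\mathcal Z_f$ is a compact convex polytope with $\mathcal M_\infty\subseteq\mathcal Z_f\subseteq\mathcal Z$, $K\mathcal Z_f\oplus\mathcal V\subseteq\hat{\mathcal U}$, and $\mathcal A_K\mathcal Z_f\oplus\Omega\subseteq\mathcal Z_f$. **(A7)** There is $h\in\Delta^{T-L}$ with $H_{u_{[0:L-1]}}h=\operatorname{col}(u^d_{T-L},\dots,u^d_{T-1})$ and $\hat H_{x_{[0:L-1]}}h=\operatorname{col}(\hat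 x^d_{T-L},\dots,\hat x^d_{T-1})$. **OCP$(\hat x_k)$.** Minimize over $Z_k=(z_{0|k},\dots,z_{L|k})$, $V_k=(v_{0|k},\dots,v_{L-1|k})$ (and $v_{L|k}$), $g$ the cost $\sum_{\ell=0}^{L-1}\bigl(z_{\ell|k}^\top Qz_{\ell|k}+u_{\ell|k}^\top Ru_{\ell|k}\bigr)+z_{L|k}^\top P_Lz_{L|k}$, $u_{\ell|k}=v_{\ell|k}+Kz_{\ell|k}$, with $Q,R,P_L\succ0$, subject to: $z_{0|k}-\hat x_k\in\mathcal E$; $z_{\ell|k}=\hat H_{x_{[\ell]}}g$ and $v_{\ell|k}=(H_{u_{[\ell]}}-K\hat H_{x_{[\ell]}})g$ for $\ell\in\mathbb N_{0:L}$; $g\in\Delta^{T-L}$; $z_{\ell|k}\in\mathcal Z$ for $\ell\in\mathbb N_{1:L}$; $v_{\ell|k}+Kz_{\ell|k}\in\hat{\mathcal U}$ for $\ell\in\mathbb N_{0:L-1}$; $z_{L|k}\in\mathcal Z_f$. The optimal pair $(Z_k^\star,V_k^\star)$ is unique whenever the problem is feasible. **Feasible set.** $\hat{\mathcal X}_L^{\mathrm{feas}}$ is the set of $\hat x\in\mathbb R^n$ for which OCP$(\hat x)$ is feasible.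
   Formalization: The noise polytope W is additionally assumed symmetric (W = −W); without this the claim fails, e.g. for W = [0,1], where the difference of two residuals need not lie in D. *)

(* Defs.v *)
(* MathComp-Analysis *)
From HB Require Import structures.
From mathcomp Require Import all_boot all_order all_algebra.
From mathcomp Require Import all_classical all_reals all_analysis.

Set Implicit Arguments.
Unset Strict Implicit.
Unset Printing Implicit Defensive.

Import Order.TTheory GRing.Theory Num.Theory.
Import numFieldNormedType.Exports.

Local Open Scope classical_set_scope.
Local Open Scope ring_scope.

(** * Sets *)

Definition msum (R : realType) (n : nat) (A B : set 'cV[R]_n) : set 'cV[R]_n :=
  [set a + b | a in A & b in B].

Definition pdiff (R : realType) (n : nat) (A B : set 'cV[R]_n) : set 'cV[R]_n :=
  [set x | msum [set x] B `<=` A].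

Definition sscale (R : realType) (n : nat) (t : R) (A : set 'cV[R]_n) :
  set 'cV[R]_n := [set t *: a | a in A].

Definition conv_hull (R : realType) (n : nat) (A : set 'cV[R]_n) :
  set 'cV[R]_n := smallest (@convex_set R 'cV[R]_n) A.

Definition mximage (R : realType) (p n : nat) (M : 'M[R]_(p, n))
  (S : set 'cV[R]_n) : set 'cV[R]_p := [set M *m s | s in S].

Definition mxsimage (R : realType) (p n : nat) (F : set 'M[R]_(p, n))
  (S : set 'cV[R]_n) : set 'cV[R]_p := [set M *m s | M in F & s in S].

Definition polyhedron (R : realType) (q n : nat) (G : 'M[R]_(q, n))
  (h : 'cV[R]_q) : set 'cV[R]_n := [set x | forall i, (G *m x) i 0 <= h i 0].

(* Convexity is automatic.  Compactness is not included: it is required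
   separately for each set that is assumed compact. *)
Definition polytope (R : realType) (n : nat) (S : set 'cV[R]_n) : Prop :=
  exists q (G : 'M[R]_(q, n)) (h : 'cV[R]_q), S = polyhedron G h.

Definition simplex (R : realType) (N : nat) : set 'cV[R]_N :=
  [set g | (forall j, 0 <= g j 0) /\ \sum_j g j 0 = 1].

(* The value is +oo when x lies in no t W. *)
Definition gauge (R : realType) (n : nat) (W : set 'cV[R]_n) (x : 'cV[R]_n) :
  \bar R := ereal_inf [set t%:E | t in [set t : R | 0 <= t /\ sscale t W x]].

Definition gauge_gain (R : realType) (n : nat) (W : set 'cV[R]_n)
  (A : 'M[R]_n) : \bar R := ereal_sup [set gauge W (A *m w) | w in W].

(** * Matrices *)

Definition posdef (R : realType) (n : nat) (M : 'M[R]_n) : Prop :=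
  M^T = M /\ forall x : 'cV[R]_n, x != 0 -> 0 < (x^T *m M *m x) 0 0.

Definition loewner_le (R : realType) (n : nat) (M N : 'M[R]_n) : Prop :=
  forall x : 'cV[R]_n, (x^T *m M *m x) 0 0 <= (x^T *m N *m x) 0 0.

Definition controllable (R : realType) (n m : nat) (A : 'M[R]_n)
  (B : 'M[R]_(n, m)) : Prop := \rank (\mxrow_(i < n) (A ^+ i *m B)) = n.

(* Block row l of a block Hankel matrix with N columns:
   [s_l, s_{l+1}, ..., s_{l+N-1}]. *)
Definition hankel_row (R : realType) (p : nat) (s : nat -> 'cV[R]_p)
  (N l : nat) : 'M[R]_(p, N) := \matrix_(i, j) s (l + j)%N i 0.

(* Block rows 0, ..., d-1; the depth-d Hankel matrix of s_0, ..., s_{T-1} is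
   [hankel s d (T - d + 1)]. *)
Definition hankel (R : realType) (p : nat) (s : nat -> 'cV[R]_p) (d N : nat) :
  'M[R]_(\sum_(l < d) p, N) := \mxcol_(l < d) hankel_row s N l.

(* [d] is the depth of the Hankel matrix. *)
Definition persistently_exciting (R : realType) (p : nat)
  (s : nat -> 'cV[R]_p) (T d : nat) : Prop :=
  \rank (hankel s d (T.+1 - d)) = (p * d)%N.

(** * Data available to the controller *)

(* [udat] and [xdat] are the input and noisy state data; only their values at
   indices below [Tlen] matter. *)
Record mpc (R : realType) (n m q : nat) := Mpc {
  Lhor : nat;
  Tlen : nat;
  udat : nat -> 'cV[R]_m;
  xdat : nat -> 'cV[R]_n;
  Gw : 'M[R]_(q, n);
  hw : 'cV[R]_q;
  gam : R;
  Kfb : 'M[R]_(m, n);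
  Uset : set 'cV[R]_m;
  Xset : set 'cV[R]_n;
  Eset : set 'cV[R]_n;
  Vset : set 'cV[R]_m;
  Zfset : set 'cV[R]_n;
  Qc : 'M[R]_n;
  Rc : 'M[R]_m;
  Pc : 'M[R]_n }.

Definition Wset (R : realType) (n m q : nat) (d : mpc R n m q) :
  set 'cV[R]_n := polyhedron (Gw d) (hw d).

Definition models (R : realType) (n m q : nat) (d : mpc R n m q) :
  set ('M[R]_n * 'M[R]_(n, m)) :=
  [set AB | forall i, (i.+1 < Tlen d)%N ->
     polyhedron (Gw d) ((1 + gam d) *: hw d)
       (xdat d i.+1 - AB.1 *m xdat d i - AB.2 *m udat d i)].

Definition AK (R : realType) (n m q : nat) (d : mpc R n m q) : set 'M[R]_n :=
  [set AB.1 + AB.2 *m Kfb d | AB in models d].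

Fixpoint AKprod (R : realType) (n m q : nat) (d : mpc R n m q) (i : nat) :
  set 'M[R]_n :=
  if i is j.+1 then [set M *m N | M in AK d & N in AKprod d j]
  else [set 1%:M].

Definition Dset (R : realType) (n m q : nat) (d : mpc R n m q) :
  set 'cV[R]_n := sscale (2 * (1 + gam d)) (Wset d).

Definition Eoff (R : realType) (n m q : nat) (d : mpc R n m q) :
  set 'cV[R]_n := sscale (1 + gam d) (Wset d).

Definition Eon (R : realType) (n m q : nat) (d : mpc R n m q) :
  set 'cV[R]_n := conv_hull (mxsimage (AK d) (Eset d)).

Definition Ew (R : realType) (n m q : nat) (d : mpc R n m q) :
  set 'cV[R]_n := sscale (gam d) (Wset d).

Definition Zset (R : realType) (n m q : nat) (d : mpc R n m q) :
  set 'cV[R]_n := pdiff (pdiff (pdiff (Xset d) (Eoff d)) (Eon d)) (Ew d).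

Definition Uhat (R : realType) (n m q : nat) (d : mpc R n m q) :
  set 'cV[R]_m := pdiff (Uset d) (mximage (Kfb d) (Eset d)).

Definition BV (R : realType) (n m q : nat) (d : mpc R n m q) :
  set 'cV[R]_n :=
  conv_hull [set AB.2 *m v | AB in models d & v in Vset d].

Definition Omega (R : realType) (n m q : nat) (d : mpc R n m q) :
  set 'cV[R]_n := msum (sscale (1 + gam d) (Wset d)) (BV d).

(* The infinite Minkowski sum is the set of sums of convergent series. *)
Definition Minf (R : realType) (n m q : nat) (d : mpc R n m q) :
  set 'cV[R]_n :=
  [set x | exists s : nat -> 'cV[R]_n,
     (forall i, conv_hull (mxsimage (AKprod d i) (Omega d)) (s i)) /\
     series s @ \oo --> x].

(** * Optimal control problem *)

Definition Hx (R : realType) (n m q : nat) (d : mpc R n m q) (l : nat) :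
  'M[R]_(n, (Tlen d - Lhor d)%N) := hankel_row (xdat d) (Tlen d - Lhor d) l.

Definition Hu (R : realType) (n m q : nat) (d : mpc R n m q) (l : nat) :
  'M[R]_(m, (Tlen d - Lhor d)%N) := hankel_row (udat d) (Tlen d - Lhor d) l.

(* [v] also carries the entry of index L, which does not enter the cost. *)
Definition ocp_constraints (R : realType) (n m q : nat) (d : mpc R n m q)
  (xh : 'cV[R]_n) (z : 'I_(Lhor d).+1 -> 'cV[R]_n)
  (v : 'I_(Lhor d).+1 -> 'cV[R]_m) (g : 'cV[R]_(Tlen d - Lhor d)) : Prop :=
  [/\ Eset d (z ord0 - xh),
      forall l, z l = Hx d l *m g /\ v l = (Hu d l - Kfb d *m Hx d l) *m g,
      simplex g,
      forall l : 'I_(Lhor d).+1, (0 < l)%N -> Zset d (z l) &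
      (forall l : 'I_(Lhor d).+1, (l < Lhor d)%N ->
         Uhat d (v l + Kfb d *m z l)) /\
      Zfset d (z ord_max)].

Arguments ocp_constraints [R n m q] d xh z v g.

Definition ocp_cost (R : realType) (n m q : nat) (d : mpc R n m q)
  (z : 'I_(Lhor d).+1 -> 'cV[R]_n) (v : 'I_(Lhor d).+1 -> 'cV[R]_m) : R :=
  \sum_(l < (Lhor d).+1 | (l < Lhor d)%N)
     (((z l)^T *m Qc d *m z l) 0 0 +
      ((v l + Kfb d *m z l)^T *m Rc d *m (v l + Kfb d *m z l)) 0 0)
  + ((z ord_max)^T *m Pc d *m z ord_max) 0 0.

Arguments ocp_cost [R n m q] d z v.

Definition ocp_optimal (R : realType) (n m q : nat) (d : mpc R n m q)
  (xh : 'cV[R]_n) (z : 'I_(Lhor d).+1 -> 'cV[R]_n)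
  (v : 'I_(Lhor d).+1 -> 'cV[R]_m) : Prop :=
  (exists g, ocp_constraints d xh z v g) /\
  (forall z' v' g', ocp_constraints d xh z' v' g' ->
     ocp_cost d z v <= ocp_cost d z' v').

Arguments ocp_optimal [R n m q] d xh z v.

Definition Xfeas (R : realType) (n m q : nat) (d : mpc R n m q) :
  set 'cV[R]_n :=
  [set xh | exists z v g, ocp_constraints d xh z v g].

(* When the problem is infeasible at time k, u_k is unconstrained. *)
Definition closed_loop (R : realType) (n m q : nat) (d : mpc R n m q)
  (A : 'M[R]_n) (B : 'M[R]_(n, m))
  (x w : nat -> 'cV[R]_n) (u : nat -> 'cV[R]_m) : Prop :=
  [/\ forall k, x k.+1 = A *m x k + B *m u k,
      forall k, Wset d (w k) &
      forall k, Xfeas d (x k + w k) ->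
        exists z v, ocp_optimal d (x k + w k) z v /\
          u k = v ord0 + Kfb d *m (x k + w k)].

(** * Assumptions *)

Definition constraint_sets (R : realType) (n m q : nat) (d : mpc R n m q) :
  Prop :=
  [/\ polytope (Uset d), (Uset d)^° 0, polytope (Xset d) & (Xset d)^° 0].

(* [xd] is the unmeasured noise-free state behind the data. *)
Definition offline_data (R : realType) (n m q : nat) (d : mpc R n m q)
  (A : 'M[R]_n) (B : 'M[R]_(n, m)) (xd wd : nat -> 'cV[R]_n) : Prop :=
  [/\ (0 < Lhor d < Tlen d)%N,
      forall i, (i.+1 < Tlen d)%N -> xd i.+1 = A *m xd i + B *m udat d i,
      forall i, (i < Tlen d)%N -> xdat d i = xd i + wd i &
      persistently_exciting (udat d) (Tlen d) (Lhor d + n + 1)%N].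

(* Online noise samples are covered by [closed_loop].  Symmetry W = -W is not
   part of this definition but has to be assumed next to it: it is what puts
   w' - A w in (1 + gam) W, hence the true system in [models], and the
   difference of two such residuals in [Dset]. *)
Definition noise_bound (R : realType) (n m q : nat) (d : mpc R n m q)
  (A : 'M[R]_n) (wd : nat -> 'cV[R]_n) : Prop :=
  [/\ compact (Wset d), Wset d 0,
      forall i, (i < Tlen d)%N -> Wset d (wd i) &
      (gauge_gain (Wset d) A <= (gam d)%:E)%E].

Definition data_full_rank (R : realType) (n m q : nat) (d : mpc R n m q) :
  Prop :=
  \rank (col_mx (hankel_row (xdat d) (Tlen d).-1 0%N)
                (hankel_row (udat d) (Tlen d).-1 0%N)) = (n + m)%N.

Definition robust_gain (R : realType) (n m q : nat) (d : mpc R n m q) : Prop :=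
  exists (P : 'M[R]_n) (b : R), [/\ posdef P, 0 < b &
    forall AB, models d AB ->
      loewner_le ((AB.1 + AB.2 *m Kfb d) *m P *m (AB.1 + AB.2 *m Kfb d)^T - P)
                 (- b%:M)].

Definition initial_set (R : realType) (n m q : nat) (d : mpc R n m q) : Prop :=
  [/\ polytope (Eset d), compact (Eset d) &
      msum (mxsimage (AK d) (Eset d)) (Dset d) `<=` Eset d].

Definition tightened_nonempty (R : realType) (n m q : nat) (d : mpc R n m q) :
  Prop := Zset d !=set0 /\ Uhat d !=set0.

Definition virtual_inputs (R : realType) (n m q : nat) (d : mpc R n m q) :
  Prop :=
  [/\ polytope (Vset d), compact (Vset d) &
      forall g, simplex g ->
        Vset d ((Hu d (Lhor d) - Kfb d *m Hx d (Lhor d)) *m g)].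

Definition terminal_set (R : realType) (n m q : nat) (d : mpc R n m q) : Prop :=
  [/\ polytope (Zfset d) /\ compact (Zfset d),
      Minf d `<=` Zfset d,
      Zfset d `<=` Zset d,
      msum (mximage (Kfb d) (Zfset d)) (Vset d) `<=` Uhat d &
      msum (mxsimage (AK d) (Zfset d)) (Omega d) `<=` Zfset d].

Definition data_continuation (R : realType) (n m q : nat) (d : mpc R n m q) :
  Prop :=
  exists h : 'cV[R]_(Tlen d - Lhor d),
    [/\ simplex h,
        hankel (udat d) (Lhor d) (Tlen d - Lhor d) *m h =
          \mxcol_(l < Lhor d) udat d (Tlen d - Lhor d + l)%N &
        hankel (xdat d) (Lhor d) (Tlen d - Lhor d) *m h =
          \mxcol_(l < Lhor d) xdat d (Tlen d - Lhor d + l)%N].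

(* Main.v *)
Require Import Defs.
From HB Require Import structures.
From mathcomp Require Import all_boot all_order all_algebra.
From mathcomp Require Import all_classical all_reals all_analysis.
From mathcomp Require Import ring zify.

(* Let (z, v, g) be feasible at time k and let h be the weights of (A7).  Moving
   the weights g one column to the right, and spreading the weight that falls
   off the last column according to h, gives g' with z'_l = z_{l+1} and
   v'_l = v_{l+1} for l < L.  Since W is symmetric, the true system is a model,
   and the residuals of any model along the data lie in (1 + gam) W, as do their
   convex combinations.  Hence z'_0 = z_1 differs from the next measurement by
   an element of A_K E + D, and z'_L lies in A_K Z_f + Omega. *)

Set Implicit Arguments.
Unset Strict Implicit.
Unset Printing Implicit Defensive.

Import Order.TTheory GRing.Theory Num.Theory.
Import numFieldNormedType.Exports.

Local Open Scope classical_set_scope.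
Local Open Scope ring_scope.


Lemma polyhedronD (R : realType) (q n : nat) (G : 'M[R]_(q, n))
  (a b : 'cV[R]_q) (x y : 'cV[R]_n) :
  polyhedron G a x -> polyhedron G b y -> polyhedron G (a + b) (x + y).
Proof. by move=> xa yb i; rewrite mulmxDr mxE [leRHS]mxE; exact: lerD. Qed.

Lemma polyhedron_scale (R : realType) (q n : nat) (G : 'M[R]_(q, n))
  (h : 'cV[R]_q) (t : R) (x : 'cV[R]_n) : 0 < t ->
  polyhedron G (t *: h) x -> sscale t (polyhedron G h) x.
Proof.
move=> t0 xh; exists (t^-1 *: x); last first.
  by rewrite scalerA mulfV ?scale1r // gt_eqF.
move=> i; rewrite -scalemxAr mxE ler_pdivrMl //.
by have := xh i; rewrite [leRHS]mxE.
Qed.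

Section gauge.
Variables (R : realType) (q n : nat) (G : 'M[R]_(q, n)) (h : 'cV[R]_q).

Lemma gauge_ge0 (W : set 'cV[R]_n) (x : 'cV[R]_n) : (0 <= gauge W x)%E.
Proof. by apply: le_ereal_inf_tmp => _ [t [t0 _] <-]; rewrite lee_fin. Qed.

(** A point of [W] is needed: over an empty set the supremum is -oo. *)
Lemma gauge_gain_ge0 (W : set 'cV[R]_n) (A : 'M[R]_n) :
  W !=set0 -> (0 <= gauge_gain W A)%E.
Proof.
move=> [w Ww]; apply: le_trans (gauge_ge0 W (A *m w)) _.
by apply: ereal_sup_ubound; exists w.
Qed.

(** The infimum is not shown to be attained, so row i is bounded up to an arbitrary e > 0, using a
    scaling t that may slightly exceed c. Since 0 is in the polyhedron, every [h i 0] is nonnegative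
    and the row bound is monotone in t. *)
Lemma gauge_polyhedron (c : R) (x : 'cV[R]_n) : polyhedron G h 0 ->
  (gauge (polyhedron G h) x <= c%:E)%E -> polyhedron G (c *: h) x.
Proof.
move=> h0 xc i.
have hi : 0 <= h i 0 by have := h0 i; rewrite mulmx0 mxE.
rewrite [leRHS]mxE; apply/ler_addgt0Pr => e e0.
have hi1 : 0 < h i 0 + 1 by rewrite ltr_wpDl.
(* The slack times [h i 0] is at most e; the + 1 keeps the denominator positive when [h i 0]
   vanishes. *)
have /ereal_inf_lt[_ [t [t0 [y hy <-]] <-]] :
    (gauge (polyhedron G h) (x) < (c + e / (h i 0 + 1))%:E)%E.
  by apply: le_lt_trans xc _; rewrite lte_fin ltrDl divr_gt0.
rewrite lte_fin => tc; rewrite -scalemxAr mxE.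
apply: (@le_trans _ _ ((c + e / (h i 0 + 1)) * h i 0)).
  by apply: le_trans (ler_wpM2r hi (ltW tc)); exact: ler_wpM2l (hy i).
rewrite mulrDl lerD2l mulrAC ler_pdivrMr // ler_wpM2l ?(ltW e0) //.
by rewrite lerDl.
Qed.

Lemma gauge_gain_polyhedron (A : 'M[R]_n) (c : R) (x : 'cV[R]_n) :
  polyhedron G h 0 -> (gauge_gain (polyhedron G h) A <= c%:E)%E ->
  polyhedron G h x -> polyhedron G (c *: h) (A *m x).
Proof.
move=> h0 Ac hx; apply: gauge_polyhedron => //; apply: le_trans Ac.
by apply: ereal_sup_ubound; exists x.
Qed.

End gauge.

Section hankel.
Variable R : realType.

Lemma hankel_row_mulE (p : nat) (s : nat -> 'cV[R]_p) (N l : nat)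
  (g : 'cV[R]_N) : hankel_row s N l *m g = \sum_j g j 0 *: s (l + j)%N.
Proof.
apply/colP => i; rewrite mxE summxE; apply: eq_bigr => j _.
by rewrite !mxE mulrC.
Qed.

Lemma hankel_mul_mxcol (p : nat) (s : nat -> 'cV[R]_p) (D N : nat)
  (h : 'cV[R]_N) (t : nat -> 'cV[R]_p) :
  hankel s D N *m h = \mxcol_(l < D) t l ->
  forall l, (l < D)%N -> hankel_row s N l *m h = t l.
Proof.
by rewrite /hankel mxcol_mul => /eq_mxcolP hs l lD; exact: (hs (Ordinal lD)).
Qed.

Lemma simplex_polyhedron (q n : nat) (G : 'M[R]_(q, n)) (c : 'cV[R]_q)
  (N : nat) (g : 'cV[R]_N) (r : 'I_N -> 'cV[R]_n) : simplex g ->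
  (forall j, polyhedron G c (r j)) -> polyhedron G c (\sum_j g j 0 *: r j).
Proof.
move=> [g0 g1] rc i; rewrite mulmx_sumr summxE -[c i 0]mul1r -g1 mulr_suml.
apply: ler_sum => j _; rewrite -scalemxAr mxE.
by apply: ler_wpM2l; [exact: g0|exact: rc].
Qed.

(** All columns of row l.+1 but the last occur in row l, one place to the right. The last one,
    [s (N + l)], lies beyond row l, and [h] reproduces it. As g' depends neither on [s] nor on l, it
    serves states and inputs at all steps. *)
Lemma simplex_shift (N : nat) (g h : 'cV[R]_N) : (0 < N)%N ->
  simplex g -> simplex h ->
  exists2 g' : 'cV[R]_N, simplex g' &
    forall p (s : nat -> 'cV[R]_p) l, hankel_row s N l *m h = s (N + l)%N ->
      hankel_row s N l *m g' = hankel_row s N l.+1 *m g.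
Proof.
case: N g h => // N g h _ [g0 g1] [h0 h1].
(* The weights g moved right by one: entry 0 is empty and the last weight of g is lost, to be
   restored through [h]. *)
pose f : 'cV[R]_N.+1 :=
  \col_j (if unlift ord0 j is Some i then g (widen_ord (leqnSn N) i) 0 else 0).
have f0 : f ord0 0 = 0 by rewrite mxE unlift_none.
have fS i : f (lift ord0 i) 0 = g (widen_ord (leqnSn N) i) 0.
  by rewrite mxE liftK.
exists (f + g ord_max 0 *: h).
  split=> [j|].
    rewrite mxE [X in _ + X]mxE addr_ge0 ?mulr_ge0 // mxE.
    by case: unlift.
  under eq_bigr do rewrite mxE [X in _ + X]mxE.
  rewrite big_split /= -mulr_sumr h1 mulr1 big_ord_recl f0 add0r.
  by under eq_bigr do rewrite fS; rewrite -g1 big_ord_recr.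
move=> p s l hs; rewrite mulmxDr -scalemxAr hs !hankel_row_mulE.
rewrite big_ord_recl f0 scale0r add0r [RHS]big_ord_recr /=.
congr (_ + _ *: s _); last by rewrite addSnnS addnC.
by apply: eq_bigr => i _; rewrite fS /= /bump /= add1n addnS addSn.
Qed.

End hankel.

Section data.
Variables (R : realType) (n m q : nat) (d : mpc R n m q).
Variables (A : 'M[R]_n) (B : 'M[R]_(n, m)).

(** This makes 1 + gam positive, as [polyhedron_scale] requires. *)
Lemma gam_ge0 (wd : nat -> 'cV[R]_n) : noise_bound d A wd -> 0 <= gam d.
Proof.
move=> [_ W0 _ Ag]; rewrite -lee_fin; apply: le_trans Ag.
by apply: gauge_gain_ge0; exists 0.
Qed.

(** By symmetry -b is in W, so A (-b) is in gam W; adding a gives the factor 1 + gam. *)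
Lemma noise_residual (wd : nat -> 'cV[R]_n) (a b : 'cV[R]_n) :
  noise_bound d A wd ->
  (forall w0, Wset d w0 -> Wset d (- w0)) -> Wset d a -> Wset d b ->
  polyhedron (Gw d) ((1 + gam d) *: hw d) (a - A *m b).
Proof.
move=> [_ W0 _ Ag] Wsym Wa Wb; rewrite scalerDl scale1r -mulmxN.
by apply: polyhedronD => //; apply: gauge_gain_polyhedron => //; exact: Wsym.
Qed.

Lemma true_model (xd wd : nat -> 'cV[R]_n) :
  offline_data d A B xd wd -> noise_bound d A wd ->
  (forall w0, Wset d w0 -> Wset d (- w0)) -> models d (A, B).
Proof.
move=> [_ xdS xdatE _] nb Wsym i iT /=; have [_ _ Wwd _] := nb.
have iT' := ltnW iT; rewrite !xdatE // xdS //.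
rewrite (_ : _ - _ - _ = wd i.+1 - A *m wd i).
  by apply: (noise_residual nb) => //; exact: Wwd.
by rewrite mulmxDr; apply/colP => j; rewrite !mxE; ring.
Qed.

Lemma model_Hx (l : nat) (g : 'cV[R]_(Tlen d - Lhor d)) :
  models d (A, B) -> simplex g -> (l < Lhor d)%N ->
  polyhedron (Gw d) ((1 + gam d) *: hw d)
    (Hx d l.+1 *m g - A *m (Hx d l *m g) - B *m (Hu d l *m g)).
Proof.
move=> AB sg lL; rewrite /Hx /Hu !hankel_row_mulE !mulmx_sumr -!sumrB.
under eq_bigr do rewrite -!scalemxAr -!scalerBr.
apply: simplex_polyhedron sg _ => j; apply: (AB (l + j)%N).
(* Column j uses the samples l + j and l + j + 1; the latter is below T because l < L and j < T -
   L. *)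
by have := ltn_ord j; lia.
Qed.

End data.

Section step.
Variables (R : realType) (n m q : nat) (d : mpc R n m q).
Variables (A : 'M[R]_n) (B : 'M[R]_(n, m)).
Variables (g : 'cV[R]_(Tlen d - Lhor d)).
Hypotheses (AB : models d (A, B)) (sg : simplex g) (gam0 : 0 <= gam d).

(** With z_l and u_l the products of [Hx d l] and [Hu d l] with [g], the difference is (A + B K)(z_0
    - xh) plus the data residual z_1 - A z_0 - B u_0 plus -e. The last two each lie in (1 + gam) W,
    which explains the factor 2 in [Dset]. In the closed loop, e is w_{k+1} - A w_k. *)
Lemma initial_step (xh : 'cV[R]_n) (e : 'cV[R]_n) : (0 < Lhor d)%N ->
  initial_set d ->
  Eset d (Hx d 0 *m g - xh) ->
  polyhedron (Gw d) ((1 + gam d) *: hw d) (- e) ->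
  Eset d (Hx d 1 *m g - (A *m xh + B *m
    ((Hu d 0 - Kfb d *m Hx d 0) *m g + Kfb d *m xh) + e)).
Proof.
move=> L0 [_ _ invE] zE eW; apply: invE.
exists ((A + B *m Kfb d) *m (Hx d 0 *m g - xh)).
  by exists (A + B *m Kfb d); [exists (A, B)|exists (Hx d 0 *m g - xh)].
exists (Hx d 1 *m g - A *m (Hx d 0 *m g) - B *m (Hu d 0 *m g) - e).
  apply: polyhedron_scale; first by rewrite mulr_gt0 // ltr_wpDr.
  rewrite -scalerA scaler_nat mulr2n.
  by apply: polyhedronD eW; apply: model_Hx AB sg L0.
rewrite !(mulmxDl, mulmxDr, mulmxN, mulNmx, mulmxA).
by apply/colP => j; rewrite !mxE; ring.
Qed.

(** The candidate at step L - 1 has state z_L and input K z_L + v with v in V by (A5). Its successor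
    is therefore (A + B K) z_L plus a residual plus B v, and the last two sum to an element of
    [Omega]. *)
Lemma terminal_step (g' : 'cV[R]_(Tlen d - Lhor d)) : simplex g' ->
  (0 < Lhor d)%N ->
  Hx d (Lhor d).-1 *m g' = Hx d (Lhor d) *m g ->
  Hu d (Lhor d).-1 *m g' = Hu d (Lhor d) *m g ->
  virtual_inputs d -> terminal_set d ->
  Zfset d (Hx d (Lhor d) *m g) -> Zfset d (Hx d (Lhor d) *m g').
Proof.
move=> sg' L0 xg' ug' [_ _ vV] [_ _ _ _ invZ] zZ; apply: invZ.
set v := (Hu d (Lhor d) - Kfb d *m Hx d (Lhor d)) *m g.
exists ((A + B *m Kfb d) *m (Hx d (Lhor d) *m g)).
  by exists (A + B *m Kfb d); [exists (A, B)|exists (Hx d (Lhor d) *m g)].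
exists (Hx d (Lhor d) *m g' - A *m (Hx d (Lhor d) *m g)
  - B *m (Hu d (Lhor d) *m g) + B *m v).
  exists (Hx d (Lhor d) *m g' - A *m (Hx d (Lhor d) *m g)
    - B *m (Hu d (Lhor d) *m g)).
    apply: polyhedron_scale; first by rewrite ltr_wpDr.
    have := @model_Hx _ _ _ _ _ _ _ (Lhor d).-1 _ AB sg'.
    by rewrite prednK // xg' ug'; apply.
  exists (B *m v) => //; apply: sub_gen_smallest.
  by exists (A, B) => //; exists v => //; exact: vV.
rewrite /v !(mulmxDl, mulmxDr, mulmxN, mulNmx, mulmxA).
by apply/colP => j; rewrite !mxE; ring.
Qed.

End step.

Theorem theorem1 (R : realType) (n m q : nat) (d : mpc R n m q)
  (Astar : 'M[R]_n) (Bstar : 'M[R]_(n, m)) (xd wd : nat -> 'cV[R]_n)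
  (x w : nat -> 'cV[R]_n) (u : nat -> 'cV[R]_m)
  (hctrl : controllable Astar Bstar)
  (hUX : constraint_sets d)
  (hA1 : offline_data d Astar Bstar xd wd)
  (hA2 : noise_bound d Astar wd)
  (hWsym : forall w0, Wset d w0 -> Wset d (- w0))
  (hA3 : data_full_rank d)
  (hK : robust_gain d)
  (hE : initial_set d)
  (hA4 : tightened_nonempty d)
  (hA5 : virtual_inputs d)
  (hA6 : terminal_set d)
  (hA7 : data_continuation d)
  (hQ : posdef (Qc d)) (hR : posdef (Rc d)) (hP : posdef (Pc d))
  (hcl : closed_loop d Astar Bstar x w u) :
  (forall k, Xfeas d (x k + w k) -> Xfeas d (x k.+1 + w k.+1)) /\
  (Xfeas d (x 0%N + w 0%N) -> forall k, Xfeas d (x k + w k)).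
Proof.
suff step k : Xfeas d (x k + w k) -> Xfeas d (x k.+1 + w k.+1).
  by split=> // h0; elim=> // k; exact: step.
have [xS Ww uE] := hcl; have [/andP[L0 LT] _ _ _] := hA1.
have [_ _ ZfZ KZf _] := hA6.
have gam0 := gam_ge0 hA2; have AB := true_model hA1 hA2 hWsym.
have [_ _ vV] := hA5.
move=> /uE[z [v [[[g [z0E zvE sg zZ [vU zZf]]] _] uk]]].
have [h [sh hu hx]] := hA7.
have NT : (0 < Tlen d - Lhor d)%N by rewrite subn_gt0.
have [g' sg' g'E] := simplex_shift NT sg sh.
have Hx' l : (l < Lhor d)%N -> Hx d l *m g' = Hx d l.+1 *m g.
  move=> lL; apply: g'E.
  exact: (@hankel_mul_mxcol _ _ _ _ _ _
    (fun l => xdat d (Tlen d - Lhor d + l)%N) hx).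
have Hu' l : (l < Lhor d)%N -> Hu d l *m g' = Hu d l.+1 *m g.
  move=> lL; apply: g'E.
  exact: (@hankel_mul_mxcol _ _ _ _ _ _
    (fun l => udat d (Tlen d - Lhor d + l)%N) hu).
have Zg (l : nat) : (0 < l <= Lhor d)%N -> Zset d (Hx d l *m g).
  move=> /andP[l0 lL]; have lL1 : (l < (Lhor d).+1)%N by [].
  by have := zZ (Ordinal lL1) l0; rewrite (zvE _).1.
have Zfg : Zfset d (Hx d (Lhor d) *m g) by move: zZf; rewrite (zvE _).1.
have Zfg' : Zfset d (Hx d (Lhor d) *m g').
  apply: (terminal_step AB sg gam0 sg') => //.
    by rewrite Hx' ?prednK.
  by rewrite Hu' ?prednK.
exists (fun l => Hx d l *m g'), (fun l => (Hu d l - Kfb d *m Hx d l) *m g'), g'.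
split=> //.
- rewrite /= Hx' //.
  have v0E : v ord0 = (Hu d 0 - Kfb d *m Hx d 0) *m g := (zvE ord0).2.
  (* The dynamics in terms of measurements: the noise enters as w_{k+1} - A w_k. *)
  rewrite xS uk v0E (_ : _ + w k.+1 = Astar *m (x k + w k) + Bstar *m
    ((Hu d 0 - Kfb d *m Hx d 0) *m g + Kfb d *m (x k + w k)) +
    (w k.+1 - Astar *m w k)); last first.
    set b := Bstar *m _; rewrite mulmxDr.
    by apply/colP => j; rewrite !mxE; ring.
  apply: initial_step => //; first by rewrite -(zvE ord0).1.
  (* The negated disturbance is the residual of the noise samples -w_{k+1} and -w_k. *)
  rewrite opprB [Astar *m _ - _]addrC -[Astar *m _]opprK -mulmxN.
  by apply: (noise_residual hA2); exact: hWsym.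
- move=> l l0; have := ltn_ord l; rewrite ltnS leq_eqVlt => /predU1P[->|lL].
    exact: ZfZ.
  by rewrite Hx' //; exact: Zg.
- split=> // l lL.
  (* The feedback terms cancel, so the candidate input is the old input at l + 1. For l + 1 = L the
     old problem does not constrain it, and the terminal set does. *)
  rewrite !mulmxBl -!mulmxA Hx' // Hu' // subrK.
  move: (lL); rewrite leq_eqVlt => /predU1P[l1|lL1].
    rewrite l1; apply: KZf.
    exists (Kfb d *m (Hx d (Lhor d) *m g)); first by exists (Hx d (Lhor d) *m g).
    exists ((Hu d (Lhor d) - Kfb d *m Hx d (Lhor d)) *m g); first exact: vV.
    by rewrite mulmxBl -mulmxA addrC subrK.
  have lL2 : (l.+1 < (Lhor d).+1)%N by exact: ltnW.
  have := vU (Ordinal lL2) lL1.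
  by rewrite (zvE _).1 (zvE _).2 /= mulmxBl -mulmxA subrK.
Qed.
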